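(* Let $(\bar{x},\bar{y})\in X_{\rm LP}$. Suppose that $T=\{1\}$, that $a_q\le b_1$ for all $q\in Q$, that $b_1r+c<a_q$ for all $q\in Q$, and that $$\sum_{q\in Q}a_q-a_{\bar{q}}\le b_1(r+1)+c<\sum_{q\in Q}a_q\qquad\text{for all }\bar{q}\in Q.$$ Then the following hold. (a) If $|Q|\le 2$, the inequality $\sum_{q\in Q}x_q\le y_1-r$ solves the separation problem for $(\bar{x},\bar{y})$. (b) If $|Q|\ge 3$, the separation problem for $(\bar{x},\bar{y})$ is solved by the inequality $$\begin{cases} x_d\le y_1-r, & \text{if } \dfrac{\sum_{q\in Q}\bar{x}_q}{|Q|-1}\le\bar{x}_d;\\[2mm] \dfrac{1}{|Q|-1}\displaystyle\sum_{q\in Q}x_q\le y_1-r, & \text{if } \bar{x}_d<\dfrac{\sum_{q\in Q}\bar{x}_q}{|Q|-1}\le 1;\\[2mm] \displaystyle\sum_{q\in Q}x_q\le y_1-r+|Q|-2, & \text{if } \dfrac{\sum_{q\in Q}\bar{x}_q}{|Q|-1}>1.\end{cases}$$ Moreover, in both cases (a) and (b), the listed inequalities define facets of the polyhedron $P$.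
   Context: $Q$ is a nonempty finite set, $T=\{1\}$, $b_1>0$, $a_q>0$ for all $q\in Q$, $c\in\mathbb{R}$, and $\sum_{q\in Q}a_q-c>0$. The unsplittable flow arc-set is $$X=\Big\{(x,y)\in\{0,1\}^{|Q|}\times\mathbb{Z}_+^{|T|}:\ \sum_{q\in Q}a_qx_q\le\sum_{t\in T}b_ty_t+c\Big\},$$ $P=\mathrm{conv}(X)$, and $X_{\rm LP}=\{(x,y)\in[0,1]^{|Q|}\times\mathbb{R}_+^{|T|}:\sum_{q\in Q}a_qx_q\le\sum_{t\in T}b_ty_t+c\}$. Let $r=\max\{\lceil -c/b_1\rceil,0\}$ and let $d\in\operatorname{argmax}_q\{\bar{x}_q:q\in Q\}$. Separation problem for $(\bar{x},\bar{y})$: with $(x^1,y^1),\ldots,(x^u,y^u)$ the vertices of $P$, $$\max_{\alpha,\beta,\gamma}\ \bar{x}^{\top}\alpha-\bar{y}^{\top}\beta-\gamma\quad\text{s.t.}\quad (x^k)^{\top}\alpha-(y^k)^{\top}\beta-\gamma\le 0\ (k=1,\ldots,u),\quad \beta_1=1,\quad \beta_t\ge 0\ (t\in T\setminus\{1\}),$$ over $(\alpha,\beta,\gamma)\in\mathbb{R}^{|Q|}\times\mathbb{R}^{|T|}\times\mathbb{R}$. An inequality $\alpha^{\top}x\le\beta^{\top}y+\gamma$ is said to solve the separation problem if $(\alpha,\beta,\gamma)$ is an optimal solution of this problem. *)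

(* Defs.v *)
From HB Require Import structures.
From mathcomp Require Import all_boot all_order all_algebra.
From mathcomp Require Import boolp classical_sets reals convex.
Set Implicit Arguments.
Unset Strict Implicit.
Unset Printing Implicit Defensive.
Import Order.TTheory GRing.Theory Num.Theory.
Local Open Scope classical_set_scope.
Local Open Scope ring_scope.

Section Polyhedra.
Variables (R : realType) (V : vectType R).
Implicit Types (S F : set V) (p : V) (s : seq V).

Definition conv_hull S : set V := smallest (@convex_set R V) S.

(* Vertices are taken to be the extreme points. *)
Definition vertex S p : Prop :=
  S p /\ forall (u v : V) (l : R), S u -> S v -> 0 < l < 1 ->
    p = l *: u + (1 - l) *: v -> u = p /\ v = p.

Definition affinely_independent s : bool :=
  if s is v0 :: s' then free [seq v - v0 | v <- s'] else true.

(* S is nonempty and its affine hull has dimension k, i.e. k + 1 is the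
   maximum number of affinely independent points of S. *)
Definition has_affine_dim S (k : nat) : Prop :=
  (exists s, [/\ size s = k.+1, {in s, forall v, S v}
               & affinely_independent s])
  /\ (forall s, {in s, forall v, S v} -> affinely_independent s ->
        (size s <= k.+1)%N).

Definition is_facet S F : Prop :=
  exists k : nat, has_affine_dim S k.+1 /\ has_affine_dim F k.

End Polyhedra.

(* R^o is R seen as a vector space over itself, which makes this product the
   vector space R^Q x R^T; its elements are the pairs (x, y). *)
Notation flow_space R Q T := ({ffun Q -> R^o} * {ffun T -> R^o})%type.

Section UnsplittableFlow.
Variables (R : realType) (Q T : finType).
Variables (a : Q -> R) (b : T -> R) (c : R).
Local Notation E := (flow_space R Q T).
Implicit Types (p : E) (alpha : Q -> R) (beta : T -> R) (gamma : R).

Definition capacity_constraint p : Prop :=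
  \sum_q a q * p.1 q <= \sum_t b t * p.2 t + c.

Definition flow_arc_set : set E :=
  [set p : E | [/\ forall q, p.1 q = 0 \/ p.1 q = 1,
               forall t, exists n : nat, p.2 t = n%:R
             & capacity_constraint p]].

Definition flow_polyhedron : set E := conv_hull flow_arc_set.

Definition flow_LP : set E :=
  [set p : E | [/\ forall q, 0 <= p.1 q <= 1,
               forall t, 0 <= p.2 t
             & capacity_constraint p]].

Definition sep_value p alpha beta gamma : R :=
  \sum_q p.1 q * alpha q - \sum_t p.2 t * beta t - gamma.

Definition sep_feasible (t1 : T) alpha beta gamma : Prop :=
  [/\ forall p, vertex flow_polyhedron p -> sep_value p alpha beta gamma <= 0,
      beta t1 = 1
    & forall t, t != t1 -> 0 <= beta t].

(* The inequality alpha^T x <= beta^T y + gamma solves the separation problem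
   for p. *)
Definition solves_separation (t1 : T) p alpha beta gamma : Prop :=
  sep_feasible t1 alpha beta gamma
  /\ (forall alpha' beta' gamma', sep_feasible t1 alpha' beta' gamma' ->
        sep_value p alpha' beta' gamma' <= sep_value p alpha beta gamma).

(* The inequality alpha^T x <= beta^T y + gamma is valid for the polyhedron and
   the face it induces is a facet. *)
Definition defines_facet alpha beta gamma : Prop :=
  (forall p, flow_polyhedron p ->
     \sum_q alpha q * p.1 q <= \sum_t beta t * p.2 t + gamma)
  /\ is_facet flow_polyhedron
       [set p : E | flow_polyhedron p /\
                \sum_q alpha q * p.1 q = \sum_t beta t * p.2 t + gamma].

End UnsplittableFlow.

Definition min_facilities (R : realType) (b1 c : R) : int :=
  Num.max (Num.ceil (- c / b1)) 0.

(* Main.v *)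
Require Import Defs.
From HB Require Import structures.
From mathcomp Require Import all_boot all_order all_algebra.
From mathcomp Require Import boolp classical_sets reals.
From mathcomp Require Import interval_inference convex.
From mathcomp Require Import zify ring lra.
Set Implicit Arguments.
Unset Strict Implicit.
Unset Printing Implicit Defensive.
Import Order.TTheory GRing.Theory Num.Theory.
Local Open Scope classical_set_scope.
Local Open Scope ring_scope.

(** Write [m] for the integer [r]. The hypotheses imply that the point
    with 0/1 part [1_A] lies in the arc-set with [k] facilities if and only if
    [k] is at least [m], raised by one when [A] is nonempty and by one more
    when [A] is all of [Q]: capacity [m] serves no commodity, capacity [m + 1]
    serves every proper subset but not [Q], and capacity [m + 2] serves all of
    [Q] ([cover_lvlP]). So the polyhedron is the epigraph of the convex
    envelope of this level function on the cube, and both claims become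
    statements about finitely many inequalities
    [sum_(q in A) alpha q <= lvl A + gamma] ([valid_ineq]).

    Separation. Every point [(1_A, lvl A)] is a vertex
    ([vertex_lattice_point]), so feasibility in the separation problem is the
    same as validity of these set inequalities, and the optimum is the largest
    value of [alpha x - gamma] over valid pairs. Optimality of a listed
    inequality is shown by weak duality: the point [x] is dominated by a
    combination of indicator vectors whose levels average to the value that
    the listed inequality attains. When the sum of [x] is large, the
    complements of singletons, completed by the empty or the full set, have
    the right barycenter ([sum_le_cosingletons]). When one coordinate [x d]
    dominates, [x] lies in [x d] times the convex hull of the proper subsets
    containing [d]; for a given [alpha] a single such subset, found greedily,
    suffices ([sum_le_proper_set]). With two commodities, the average and the
    cover inequalities coincide, and one of the two bounds always applies.

    Facets. The polyhedron is full-dimensional, so a valid inequality defines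
    a facet as soon as the hyperplane of equality contains [#|Q| + 1] affinely
    independent points of the polyhedron and misses another of its points
    ([facet_of_hyperplane]). *)

(** * Convex hulls, extreme points and facets *)

Lemma conv_hull_le (R : realType) (V : vectType R) (S : set V)
    (f : {linear V -> R^o}) (g : R) :
  (forall p, S p -> f p <= g) -> forall p, conv_hull S p -> f p <= g.
Proof.
move=> fS p /(_ [set q | f q <= g]); apply; split=> // x y l.
rewrite !inE /= => fx fy.
rewrite linearD !linearZ /=.
have [l0 l1] : 0 <= l%:num /\ l%:num <= 1 by [].
rewrite /GRing.scale /= /unstable.onem; nra.
Qed.

Lemma conv_hull_sub (R : realType) (V : vectType R) (S : set V) p :
  S p -> conv_hull S p.
Proof. by move=> Sp A [_]; apply. Qed.

(** An affine combination strictly between two points of a half-space lies on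
    its boundary only if both points do; so supporting functionals at [p] that
    jointly separate [p] from the other points make it extreme. *)
Lemma vertex_conv_hull (R : realType) (V : vectType R) (S : set V) (p : V)
    (I : Type) (f : I -> {linear V -> R^o}) :
  S p -> (forall i u, S u -> f i u <= f i p) ->
  (forall u, (forall i, f i u = f i p) -> u = p) ->
  vertex (conv_hull S) p.
Proof.
move=> Sp fle fsep; split; first exact: conv_hull_sub.
move=> u v l Su Sv /andP[l0 l1] pE.
have fE i : f i u = f i p /\ f i v = f i p.
  have fu := conv_hull_le (fle i) Su; have fv := conv_hull_le (fle i) Sv.
  have : f i p = l * f i u + (1 - l) * f i v.
    by rewrite {1}pE linearD !linearZ.
  by move=> fpE; split; nra.
by split; apply: fsep => i; case: (fE i).
Qed.

Lemma free_family (R : fieldType) (V : vectType R) (I : finType) (w : I -> V) :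
  (forall k : I -> R, \sum_i k i *: w i = 0 -> forall i, k i = 0) ->
  free [seq w i | i <- enum I].
Proof.
move=> wfree.
apply/(@freeP R V _ (map_tuple w (enum_tuple I))) => k k0 i.
have := wfree (fun j => k (enum_rank j)).
rewrite (reindex_onto (@enum_val I I) enum_rank) /=; last first.
  by move=> j _; rewrite enum_rankK.
have E : \sum_(j < #|I| | enum_rank (@enum_val I I j) == j)
     k (enum_rank (@enum_val I I j)) *: w (enum_val j) = 0.
  rewrite -[RHS]k0; apply: eq_big => j; first by rewrite enum_valK eqxx.
  move=> _; rewrite enum_valK (nth_map (enum_val j)) ?size_tuple //.
  by congr (_ *: w _); exact: enum_val_nth.
by move=> /(_ E (enum_val i)); rewrite enum_valK.
Qed.

(** Differences of points of the hyperplane lie in the kernel of [f], and a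
    vector outside this kernel can be added to any free family in it. Applied
    to the given [s], this makes [S] full-dimensional; applied to an arbitrary
    independent family in the face, it bounds the dimension of the face. *)
Lemma facet_of_hyperplane (R : realType) (V : vectType R) (S : set V)
    (f : {linear V -> R^o}) (g : R) (s : seq V) (p : V) :
  affinely_independent s -> size s = dim V -> (0 < dim V)%N ->
  (forall v, v \in s -> S v /\ f v = g) -> S p -> f p <> g ->
  is_facet S [set v | S v /\ f v = g].
Proof.
move=> sfree ssize dimV sface Sp fp; exists (dim V).-1; rewrite prednK //.
have cons_free u v X : f u = g -> f v <> g -> {in X, forall x, f x = g} ->
    free [seq x - u | x <- X] -> free (v - u :: [seq x - u | x <- X]).
  move=> fu fv fX Xfree; rewrite free_cons Xfree andbT.
  apply/negP => vspan.
  have /span_subvP Xker : {subset [seq x - u | x <- X] <= lker (linfun f)}.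
    move=> _ /mapP[x xX ->]; rewrite memv_ker lfunE linearB /=.
    by rewrite fX // fu subrr.
  move/subvP: Xker => /(_ _ vspan).
  by rewrite memv_ker lfunE linearB /= fu subr_eq0 => /eqP.
have free_size (X : seq V) : free X -> (size X <= dim V)%N.
  by move=> /eqP <-; rewrite -dimvf dimvS ?subvf.
split; split.
- case: s sfree ssize sface => [|u s] /= sfree ssize sface.
    by rewrite -ssize in dimV.
  exists [:: u, p & s]; split; first by rewrite /= -ssize.
    move=> v; rewrite !inE => /or3P[/eqP->|/eqP->//|vs].
      by case: (sface u); rewrite ?mem_head.
    by case: (sface v); rewrite // inE vs orbT.
  apply: cons_free => //; first by case: (sface u); rewrite ?mem_head.
  by move=> x xs; case: (sface x); rewrite // inE xs orbT.
- case=> [//|u X] _ /= /free_size.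
  by rewrite size_map.
- exists s; split=> //; first by rewrite prednK.
- case=> [//|u X] XF /= Xfree.
  rewrite prednK //.
  have fX : {in X, forall x, f x = g}.
    by move=> x xX; case: (XF x); rewrite // inE xX orbT.
  have fu : f u = g by case: (XF u); rewrite ?mem_head.
  have := free_size _ (cons_free u p X fu fp fX Xfree).
  by rewrite /= size_map.
Qed.

(** * The left-hand side of an inequality as a linear form *)

Section FlowForm.
Variables (R : realType) (Q T : finType).
Local Notation E := (flow_space R Q T).

Definition flow_form (alpha : Q -> R) (beta : T -> R) (p : E) : R^o :=
  \sum_q alpha q * p.1 q - \sum_t beta t * p.2 t.

Fact flow_form_is_linear alpha beta : linear (flow_form alpha beta).
Proof.
move=> k u v; rewrite /flow_form scalerBr addrACA -opprD !scaler_sumr.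
rewrite -!big_split /=; congr (_ - _); apply: eq_bigr => i _;
  by rewrite !ffunE /GRing.scale /=; ring.
Qed.

HB.instance Definition _ alpha beta :=
  GRing.isLinear.Build R E R^o _ (flow_form alpha beta)
    (flow_form_is_linear alpha beta).

Lemma flow_formE alpha beta p gamma :
  flow_form alpha beta p = gamma <->
  \sum_q alpha q * p.1 q = \sum_t beta t * p.2 t + gamma.
Proof. by rewrite /flow_form; split=> [<-|->]; ring. Qed.

Lemma flow_form_le alpha beta p gamma :
  flow_form alpha beta p <= gamma <->
  \sum_q alpha q * p.1 q <= \sum_t beta t * p.2 t + gamma.
Proof. by rewrite /flow_form lerBlDl. Qed.

Lemma sep_valueE p alpha beta gamma :
  sep_value p alpha beta gamma = flow_form alpha beta p - gamma.
Proof.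
by congr (_ - _ - _); apply: eq_bigr => i _; rewrite mulrC.
Qed.

Lemma dim_flow_space : dim E = (#|Q| + #|T|)%N.
Proof. by rewrite /dim /= /dim /= !muln1. Qed.

End FlowForm.

(** * Arc-sets with one facility type, described by a level function *)

Section SingleFacility.
Variables (R : realType) (Q T : finType) (t1 : T).
Variables (a : Q -> R) (b : T -> R) (c : R).
Hypothesis T1 : forall t : T, t = t1.
Local Notation E := (flow_space R Q T).
Local Notation X := (flow_arc_set a b c).
Local Notation P := (flow_polyhedron a b c).

(** [lvl A] is the least number of facilities that serves the commodities
    in [A]. *)
Variable lvl : {set Q} -> nat.
Hypothesis lvlP : forall (A : {set Q}) (k : nat),
  \sum_(q in A) a q <= b t1 * k%:R + c <-> (lvl A <= k)%N.

Let y1 (t : T) : R := (t == t1)%:R.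

Definition lattice_point (A : {set Q}) (k : nat) : E :=
  ([ffun q => (q \in A)%:R], [ffun => k%:R]).

Lemma sum_single (F : T -> R) : \sum_t F t = F t1.
Proof. by rewrite (bigD1 t1) //= big1 ?addr0 // => t; rewrite (T1 t) eqxx. Qed.

Lemma sum_lattice_point (alpha : Q -> R) A k :
  \sum_q alpha q * (lattice_point A k).1 q = \sum_(q in A) alpha q.
Proof.
rewrite [RHS]big_mkcond; apply: eq_bigr => q _. rewrite /= ffunE.
by case: ifP; rewrite ?mulr1 ?mulr0.
Qed.

Lemma flow_arc_setP p :
  X p <-> exists A k, (lvl A <= k)%N /\ p = lattice_point A k.
Proof.
split=> [[p01 pnat pcap]|[A [k [Ak ->]]]]; last first.
  split=> [q|t|]; first by rewrite /= ffunE; case: (q \in A); [right|left].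
    by exists k; rewrite /= ffunE.
  by rewrite /capacity_constraint sum_lattice_point sum_single /= ffunE; apply/lvlP.
have [k pk] := pnat t1; pose A := [set q | p.1 q == 1]%SET.
have pE : p = lattice_point A k.
  rewrite (surjective_pairing p); congr (_, _); apply/ffunP => i;
    rewrite ffunE ?(T1 i) // finset.in_set.
  by case: (p01 i) => ->; rewrite ?eqxx // eq_sym oner_eq0.
exists A, k; split=> //; apply/lvlP; move: pcap.
by rewrite pE /capacity_constraint sum_lattice_point sum_single /= ffunE.
Qed.

Lemma flow_form_lattice_point alpha beta A k :
  beta t1 = 1 ->
  flow_form alpha beta (lattice_point A k) = \sum_(q in A) alpha q - k%:R.
Proof.
by move=> b1; rewrite /flow_form sum_lattice_point sum_single /= ffunE b1 mul1r.
Qed.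

(** The inequality [alpha x <= y + gamma] at the points [(1_A, lvl A)], from
    which its validity on the whole polyhedron follows because [y] has a
    positive coefficient. *)
Definition valid_ineq (alpha : Q -> R) (gamma : R) : Prop :=
  forall A : {set Q}, \sum_(q in A) alpha q <= (lvl A)%:R + gamma.

Lemma valid_ineqP alpha gamma p :
  valid_ineq alpha gamma -> P p -> flow_form alpha y1 p <= gamma.
Proof.
move=> valid; apply: conv_hull_le => _ /flow_arc_setP[A [k [Ak ->]]].
rewrite /= flow_form_lattice_point /y1 ?eqxx // lerBlDl.
by apply: le_trans (valid A) _; rewrite lerD2r ler_nat.
Qed.

(** Every function on the vertices of a cube has a supporting hyperplane at
    each vertex: make the slope towards [A] so steep that moving away from
    [1_A] in a single coordinate already loses [lvl A]. *)
Lemma supporting_ineq (A : {set Q}) : exists alpha gamma,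
  valid_ineq alpha gamma /\ \sum_(q in A) alpha q = (lvl A)%:R + gamma.
Proof.
pose K : R := (lvl A)%:R; pose alpha q := if q \in A then K else - K.
have diffE (B : {set Q}) : \sum_(q in A) alpha q - \sum_(q in B) alpha q =
    \sum_q K * ((q \in A) != (q \in B))%:R.
  rewrite [X in X - _]big_mkcond [X in _ - X]big_mkcond -sumrB /=.
  apply: eq_bigr => q _; rewrite /alpha.
  by case: (q \in A); case: (q \in B) => /=; ring.
have K0 : 0 <= K by exact: ler0n.
exists alpha, (\sum_(q in A) alpha q - K); split=> [B|]; last first.
  by rewrite addrC subrK.
have [<-|AB] := eqVneq A B; first by rewrite -/K addrC subrK.
have [q0 q0AB] : exists q, (q \in A) != (q \in B).
  apply/existsP; rewrite -negb_forall; apply: contra AB => /forallP AB.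
  by apply/eqP/setP => q; apply/eqP.
have : K <= \sum_q K * ((q \in A) != (q \in B))%:R.
  rewrite (bigD1 q0) //= q0AB mulr1 lerDl sumr_ge0 // => q _.
  by rewrite mulr_ge0.
have lvlB0 : 0 <= (lvl B)%:R :> R by exact: ler0n.
by rewrite -diffE; lra.
Qed.

(** The coordinates of [x], with signs, isolate [1_A] in the cube; the
    supporting inequality at [A] then fixes [y]. *)
Lemma vertex_lattice_point A : vertex P (lattice_point A (lvl A)).
Proof.
have [alpha [gamma [valid tight]]] := supporting_ineq A.
pose sgnA q : R := if q \in A then 1 else - 1.
pose f (i : option Q) : {linear E -> R^o} :=
  if i is Some q0 then flow_form (fun q => (q == q0)%:R * sgnA q0) (fun=> 0)
  else flow_form alpha y1.
have fSome q0 p : f (Some q0) p = sgnA q0 * p.1 q0.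
  rewrite /= /flow_form sum_single mul0r subr0 (bigD1 q0) //= eqxx mul1r.
  by rewrite big1 ?addr0 // => q /negPf->; rewrite !mul0r.
have y1t1 : y1 t1 = 1 by rewrite /y1 eqxx.
apply: (@vertex_conv_hull _ _ _ _ (option Q) f).
- by apply/flow_arc_setP; exists A, (lvl A).
- move=> [q|] u Xu.
    rewrite !fSome /= ffunE /sgnA; case: Xu => /(_ q) uq _ _.
    by case: (q \in A); case: uq => -> /=;
      rewrite !(mulr0, mulr1) ?lexx ?ler01 ?lerN10.
  rewrite [leRHS]flow_form_lattice_point // tight addrAC subrr add0r.
  by apply: valid_ineqP => //; apply: conv_hull_sub.
move=> [x y] fu.
have xA : x = [ffun q => (q \in A)%:R].
  apply/ffunP => q; have := fu (Some q); rewrite !fSome /= /sgnA.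
  by case: (q \in A); rewrite ?mul1r // !mulN1r => /oppr_inj.
congr (_, _) => //; apply/ffunP => t; rewrite ffunE (T1 t).
have /= := fu None; rewrite /flow_form sum_lattice_point.
rewrite !sum_single xA (sum_lattice_point _ A 0) ffunE y1t1 !mul1r /=.
by move/addrI/oppr_inj.
Qed.

(** As the coefficient of [y] is normalized to 1, its contribution to the
    objective is the same for all feasible solutions and cancels. *)
Lemma solves_separation_lvl (p : E) alpha gamma :
  valid_ineq alpha gamma ->
  (forall alpha' gamma', valid_ineq alpha' gamma' ->
     \sum_q alpha' q * p.1 q - gamma' <= \sum_q alpha q * p.1 q - gamma) ->
  solves_separation a b c t1 p alpha y1 gamma.
Proof.
move=> valid best; split.
  split; rewrite /y1 ?eqxx // => v [Pv _].
  by rewrite sep_valueE subr_le0; apply: valid_ineqP.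
move=> alpha' beta' gamma' [feas b1 _].
have valid' : valid_ineq alpha' gamma'.
  move=> A; have := feas _ (vertex_lattice_point A).
  by rewrite sep_valueE subr_le0 flow_form_lattice_point // lerBlDl.
rewrite !sep_valueE /flow_form !sum_single b1 /y1 eqxx.
by rewrite !mul1r addrAC [leRHS]addrAC lerD2r best.
Qed.

(** The hypothesis on [k] is the affine independence of the tight points
    [(1_(A i), lvl (A i))] together with [(1_A0, lvl A0)], taken relative to
    the latter. *)
Lemma defines_facet_lvl alpha gamma (A0 : {set Q}) (A : Q -> {set Q}) :
  valid_ineq alpha gamma ->
  \sum_(q in A0) alpha q = (lvl A0)%:R + gamma ->
  (forall i, \sum_(q in A i) alpha q = (lvl (A i))%:R + gamma) ->
  (forall k : Q -> R,
     (forall q, \sum_i k i * ((q \in A i)%:R - (q \in A0)%:R) = 0) ->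
     \sum_i k i * ((lvl (A i))%:R - (lvl A0)%:R) = 0 -> forall i, k i = 0) ->
  defines_facet a b c alpha y1 gamma.
Proof.
move=> valid tight0 tight indep; split.
  by move=> p Pp; apply/flow_form_le; apply: valid_ineqP.
pose v0 := lattice_point A0 (lvl A0).
pose v i := lattice_point (A i) (lvl (A i)).
have T1card : #|T| = 1%N.
  by rewrite -(card1 t1); apply: eq_card => t; rewrite (T1 t) !inE eqxx.
have y1t1 : y1 t1 = 1 by rewrite /y1 eqxx.
have -> : [set p | P p /\
     \sum_q alpha q * p.1 q = \sum_t y1 t * p.2 t + gamma]
   = [set p | P p /\ flow_form alpha y1 p = gamma].
  by apply/seteqP; split=> p /= [Pp /flow_formE].
have Pl (B : {set Q}) (k : nat) : (lvl B <= k)%N -> P (lattice_point B k).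
  by move=> Bk; apply: conv_hull_sub; apply/flow_arc_setP; exists B, k.
(* One facility more than needed gives a point off the hyperplane. *)
apply: (@facet_of_hyperplane _ _ _ _ _ (v0 :: [seq v i | i <- enum Q])
          (lattice_point A0 (lvl A0).+1)).
- rewrite /= -map_comp; apply: free_family => k k0.
  apply: indep => [q|].
    have /= := congr1 (fun u : E => u.1 q) k0.
    rewrite raddf_sum /= sum_ffunE ffunE => k0q; rewrite -[RHS]k0q.
    by apply: eq_bigr => i _; rewrite !ffunE.
  have /= := congr1 (fun u : E => u.2 t1) k0.
  rewrite raddf_sum /= sum_ffunE ffunE => k0q; rewrite -[RHS]k0q.
  by apply: eq_bigr => i _; rewrite !ffunE.
- by rewrite /= size_map -cardE dim_flow_space T1card addn1.
- by rewrite dim_flow_space T1card addn1.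
- move=> _ /predU1P[->|/mapP[i _ ->]]; split; try exact: Pl.
    by rewrite /= flow_form_lattice_point // tight0 addrAC subrr add0r.
  by rewrite /= flow_form_lattice_point // tight addrAC subrr add0r.
- by apply: Pl; exact: leqnSn.
- by rewrite /= flow_form_lattice_point // tight0 -[(lvl A0).+1]addn1 natrD => ?; lra.
Qed.

End SingleFacility.
(** * The level function of a minimal cover *)

Section CoverLevel.
Variables (R : realType) (Q : finType) (m : nat).
Hypothesis Q2 : (2 <= #|Q|)%N.
Implicit Types (A : {set Q}) (alpha x : Q -> R) (gamma : R).

Let n : R := #|Q|%:R.

Definition cover_lvl A : nat := m + (0 < #|A|) + (#|A| == #|Q|).

(** The hypothesis on [k] characterizes [m] as the least number of facilities
    with nonnegative capacity, which settles the empty set; the remaining ones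
    place the jumps of the level at the singletons and at [Q]. *)
Lemma cover_lvlP (a : Q -> R) (b1 c : R) :
  0 < b1 -> (forall q, 0 < a q) ->
  (forall k : nat, 0 <= b1 * k%:R + c <-> (m <= k)%N) ->
  (forall q, a q <= b1) -> (forall q, b1 * m%:R + c < a q) ->
  (forall q0, \sum_q a q - a q0 <= b1 * (m%:R + 1) + c < \sum_q a q) ->
  forall A k, \sum_(q in A) a q <= b1 * k%:R + c <-> (cover_lvl A <= k)%N.
Proof.
move=> b0 a0 mP ab bma cov A k.
have mono (i j : nat) : (i <= j)%N -> b1 * i%:R + c <= b1 * j%:R + c.
  by move=> ij; rewrite lerD2r ler_pM2l // ler_nat.
have sumDa q : \sum_p a p = a q + \sum_(p | p != q) a p by rewrite (bigD1 q).
have sumA_le q : q \notin A -> \sum_(p in A) a p <= \sum_p a p - a q.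
  move=> qA; rewrite (sumDa q) addrAC subrr add0r.
  rewrite big_mkcond [leRHS]big_mkcond /=; apply: ler_sum => p _.
  have [->|pq] := eqVneq p q; first by rewrite (negPf qA).
  by case: (p \in A); rewrite // ltW.
have leA_sum q : q \in A -> a q <= \sum_(p in A) a p.
  move=> qA; rewrite (bigD1 q) //= lerDl sumr_ge0 // => p _; exact: ltW.
have m1 : b1 * m.+1%:R + c = b1 * (m%:R + 1) + c by rewrite -natr1.
have m2 : b1 * m.+2%:R + c = b1 * (m%:R + 1) + c + b1.
  by rewrite -natr1 -natr1; ring.
rewrite /cover_lvl; case: (posnP #|A|) => [A0|Apos].
  by rewrite A0 ltn_eqF ?(ltnW Q2) //= !addn0 (cards0_eq A0) big_set0.
have [q qA] : exists q, q \in A by apply/card_gt0P.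
have [Afull|Aproper] := eqVneq #|A| #|Q|.
  have AT : A = [set: Q]%SET.
    by apply/eqP; rewrite eqEcard finset.subsetT cardsT Afull /=.
  rewrite AT (eq_bigl xpredT) => [|p]; last by rewrite finset.inE.
  rewrite /= !addn1; case/andP: (cov q) => covle covlt; split=> [le_k|le_k].
    by rewrite ltnNge; apply/negP => /mono; rewrite m1 => ?; lra.
  by apply: le_trans (mono _ _ le_k); rewrite m2; move: (ab q) => ?; lra.
rewrite /= addn0 addn1; split=> [le_k|le_k].
  rewrite ltnNge; apply/negP => /mono.
  by move: (leA_sum q qA) (bma q) => ? ? ?; lra.
have [p pA] : exists p, p \notin A.
  apply/existsP; rewrite -negb_forall; apply: contra Aproper => /forallP Aall.
  by apply/eqP/eq_card => p; rewrite Aall.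
apply: le_trans (mono _ _ le_k); rewrite m1.
by apply: le_trans (sumA_le p pA) _; case/andP: (cov p).
Qed.

Lemma cover_lvl0 : cover_lvl finset.set0 = m.
Proof. by rewrite /cover_lvl cards0 ltn_eqF ?(ltnW Q2) //= !addn0. Qed.

Lemma cover_lvlT : cover_lvl [set: Q]%SET = m.+2.
Proof. by rewrite /cover_lvl cardsT eqxx ltnW //= !addn1. Qed.

Lemma cover_lvl_mid A : (0 < #|A| < #|Q|)%N -> cover_lvl A = m.+1.
Proof.
by case/andP=> A0 AQ; rewrite /cover_lvl A0 ltn_eqF // addn0 addn1.
Qed.

Lemma cardsC1_proper (q : Q) : (0 < #|[set~ q]%SET| < #|Q|)%N.
Proof. by rewrite cardsC1; lia. Qed.

Lemma cover_lvlC1 (q : Q) : cover_lvl [set~ q]%SET = m.+1.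
Proof. exact/cover_lvl_mid/cardsC1_proper. Qed.

Lemma sum_indic d A : \sum_(q in A) (q == d)%:R = (d \in A)%:R :> R.
Proof.
have [dA|dA] := boolP (d \in A).
  by rewrite (bigD1 d) //= eqxx big1 ?addr0 // => q /andP[_ /negPf->].
by rewrite big1 // => q qA; case: eqP dA => // <-; rewrite qA.
Qed.

Lemma sum_C1 alpha q :
  \sum_(p in [set~ q]%SET) alpha p = \sum_p alpha p - alpha q.
Proof.
rewrite [in RHS](bigD1 q) //= addrAC subrr add0r.
by apply: eq_bigl => p; rewrite !finset.inE.
Qed.

Lemma n_gt1 : 1 < n.
Proof. by rewrite ltr1n. Qed.

Lemma valid_single d : valid_ineq cover_lvl (fun q => (q == d)%:R) (- m%:R : R).
Proof.
move=> A; rewrite sum_indic /cover_lvl -addnA natrD addrAC subrr add0r ler_nat.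
by have [dA|//] := boolP (d \in A); rewrite (_ : (0 < #|A|)%N) //;
  apply/card_gt0P; exists d.
Qed.

Lemma valid_average : valid_ineq cover_lvl (fun=> 1 / (n - 1)) (- m%:R : R).
Proof.
move=> A; rewrite sumr_const -[_ *+ #|A|]mulr_natl mulrA mulr1.
rewrite ler_pdivrMr ?subr_gt0 ?n_gt1 // /cover_lvl -addnA natrD addrAC subrr add0r.
rewrite /n -(natrB _ (ltnW Q2)) -natrM ler_nat.
have AQ : (#|A| <= #|Q|)%N := max_card _.
have [->//|A0] := posnP #|A|.
have [->|AneqQ] := eqVneq #|A| #|Q|; nia.
Qed.

Lemma valid_cover : valid_ineq cover_lvl (fun=> 1) (- m%:R + n - 2).
Proof.
move=> A; rewrite sumr_const.
have -> : (cover_lvl A)%:R + (- m%:R + n - 2) =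
  ((0 < #|A|) + (#|A| == #|Q|) + (#|Q| - 2))%:R :> R.
  by rewrite /cover_lvl /n !natrD natrB //; ring.
have AQ : (#|A| <= #|Q|)%N := max_card _.
rewrite ler_nat; have [->//|A0] := posnP #|A|.
by have [->|AneqQ] := eqVneq #|A| #|Q|; lia.
Qed.

(** * Weak duality for the separation problem *)

Lemma valid_bounds alpha gamma : valid_ineq cover_lvl alpha gamma ->
  [/\ 0 <= m%:R + gamma,
      forall A, (0 < #|A| < #|Q|)%N ->
        \sum_(q in A) alpha q <= 1 + (m%:R + gamma)
    & \sum_q alpha q <= 2 + (m%:R + gamma)].
Proof.
move=> valid; split.
- by have := valid finset.set0; rewrite big_set0 cover_lvl0.
- move=> A Amid; apply: le_trans (valid A) _.
  by rewrite cover_lvl_mid // -natr1; lra.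
- have := valid [set: Q]%SET; rewrite cover_lvlT (eq_bigl xpredT) => [|q]; last first.
    by rewrite finset.inE.
  by rewrite -natr1 -natr1 => ?; lra.
Qed.

(** The weight [t - x q] on the complement of [q], together with the remaining
    weight, out of a total of [t], on all of [Q], has [x] as its weighted sum
    of indicator vectors. *)
Lemma sum_le_cosingletons alpha x (t B : R) :
  (forall q, x q <= t) ->
  (forall q, \sum_p alpha p - alpha q <= B) ->
  \sum_q alpha q * x q <=
    (n * t - \sum_q x q) * B + (t - (n * t - \sum_q x q)) * \sum_q alpha q.
Proof.
move=> xt alphaB; set S := \sum_p alpha p.
have sumlam : \sum_q (t - x q) = n * t - \sum_q x q.
  by rewrite big_split /= sumr_const sumrN mulr_natl.
have sumE : \sum_q (t - x q) * (S - alpha q) =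
    (n * t - \sum_q x q) * S - t * S + \sum_q alpha q * x q.
  rewrite -sumlam mulr_suml {3}/S mulr_sumr -sumrB -big_split /=.
  by apply: eq_bigr => q _; ring.
have : \sum_q (t - x q) * (S - alpha q) <= (n * t - \sum_q x q) * B.
  rewrite -sumlam mulr_suml; apply: ler_sum => q _.
  by apply: ler_wpM2l; rewrite ?subr_ge0.
by rewrite sumE; lra.
Qed.

(** A linear function on the vectors [x] allowed here is maximized, up to the
    factor [x d], at the indicator of a proper set containing [d]: take [d] and
    all positive coefficients; if this is all of [Q], the constraint on the sum
    forces some element other than [d] to be given up, and the cheapest one is
    a minimizer [q0] of [alpha]. *)
Lemma sum_le_proper_set alpha x d :
  (forall q, 0 <= x q <= x d) -> \sum_q x q <= x d * (n - 1) ->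
  exists A, (0 < #|A| < #|Q|)%N /\
    \sum_q alpha q * x q <= x d * \sum_(q in A) alpha q.
Proof.
move=> x0d sumx.
have [i0 i0d] : exists q, q != d.
  by case/andP: (cardsC1_proper d) => /card_gt0P[q]; rewrite !finset.inE; exists q.
case: (@arg_minP _ _ _ i0 (fun q => q != d) alpha i0d) => q0 q0d q0min.
have proper A : d \in A -> q0 \notin A -> (0 < #|A| < #|Q|)%N.
  move=> dA q0A; apply/andP; split; first by apply/card_gt0P; exists d.
  rewrite -[X in (_ < X)%N]cardsT proper_card // properE finset.subsetT /=.
  by apply/subsetPn; exists q0; rewrite ?finset.inE.
have [q0neg|q0pos] := leP (alpha q0) 0.
  exists [set q | (q == d) || (0 < alpha q)]%SET; split.
    by apply: proper; rewrite !finset.inE ?eqxx // (negPf q0d) -leNgt.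
  rewrite mulr_sumr [leRHS]big_mkcond /=; apply: ler_sum => q _.
  rewrite finset.inE; have [->|qd] /= := eqVneq q d; first by rewrite mulrC.
  by case/andP: (x0d q) => ? ?; case: ltP => ?; nra.
exists [set~ q0]%SET; split; first by apply: proper; rewrite !finset.inE ?eqxx // eq_sym.
rewrite sum_C1.
(* Replacing the constant [x d] by [x] costs at least [alpha q0] per unit of
   slack, the slack at [d] is zero, and the total slack is at least [x d]. *)
have : alpha q0 * \sum_q (x d - x q) <= \sum_q alpha q * (x d - x q).
  rewrite mulr_sumr; apply: ler_sum => q _.
  have [->|qd] := eqVneq q d; first by rewrite subrr !mulr0.
  by apply: ler_wpM2r; rewrite ?q0min // subr_ge0; case/andP: (x0d q).
have -> : \sum_q alpha q * (x d - x q) =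
    x d * (\sum_q alpha q) - \sum_q alpha q * x q.
  by rewrite mulr_sumr -sumrB; apply: eq_bigr => q _; ring.
rewrite sumrB sumr_const -mulr_natl -/n.
by move: (\sum_q x q) sumx => s sumx; nra.
Qed.

Section Optimality.
Variable x : Q -> R.
Hypothesis x01 : forall q, 0 <= x q <= 1.
Let avg : R := (\sum_q x q) / (n - 1).

(** The proper set given by the previous bound receives weight [x d], and the
    empty set the rest. *)
Lemma optimal_single d alpha gamma :
  (forall q, x q <= x d) -> avg <= x d -> valid_ineq cover_lvl alpha gamma ->
  \sum_q alpha q * x q - gamma <= \sum_q (q == d)%:R * x q - - m%:R.
Proof.
move=> xd avgd /valid_bounds[g0 gmid _].
have [||A [Amid le_A]] := @sum_le_proper_set alpha x d.
- by move=> q; rewrite xd; case/andP: (x01 q) => ->.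
- by rewrite -ler_pdivrMr ?subr_gt0 ?n_gt1.
have -> : \sum_q (q == d)%:R * x q = x d.
  by rewrite (bigD1 d) //= eqxx mul1r big1 ?addr0 // => q /negPf->; rewrite mul0r.
have {}gmid := gmid A Amid.
by case/andP: (x01 d) => ? ?; nra.
Qed.

(** Here the cosingleton weights [avg - x q] add up to [avg], so nothing is left
    for [Q]; the empty set receives [1 - avg]. *)
Lemma optimal_average alpha gamma :
  (forall q, x q <= avg) -> avg <= 1 -> valid_ineq cover_lvl alpha gamma ->
  \sum_q alpha q * x q - gamma <= \sum_q 1 / (n - 1) * x q - - m%:R.
Proof.
move=> xavg avg1 /valid_bounds[g0 gmid _].
have sE : n * avg - \sum_q x q = avg.
  have n1 : n - 1 != 0 by rewrite subr_eq0 gt_eqF ?n_gt1.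
  by rewrite /avg; field.
have := @sum_le_cosingletons alpha x avg (1 + (m%:R + gamma)) xavg.
rewrite sE subrr mul0r addr0.
have -> : \sum_q 1 / (n - 1) * x q = avg.
  by rewrite -mulr_sumr mul1r mulrC.
have avg0 : 0 <= avg.
  rewrite divr_ge0 ?subr_ge0 ?(ltW n_gt1) ?sumr_ge0 // => q _.
  by case/andP: (x01 q).
have C1 q : \sum_p alpha p - alpha q <= 1 + (m%:R + gamma).
  by rewrite -sum_C1; exact/gmid/cardsC1_proper.
by move=> /(_ C1); nra.
Qed.

(** Here the cosingleton weights [1 - x q] add up to at most 1, and the rest
    goes to [Q]. *)
Lemma optimal_cover alpha gamma :
  1 <= avg -> valid_ineq cover_lvl alpha gamma ->
  \sum_q alpha q * x q - gamma <= \sum_q 1 * x q - (- m%:R + n - 2).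
Proof.
rewrite ler_pdivlMr ?subr_gt0 ?n_gt1 // mul1r => avg1 /valid_bounds[g0 gmid gT].
have x1 q : x q <= 1 by case/andP: (x01 q).
have C1 q : \sum_p alpha p - alpha q <= 1 + (m%:R + gamma).
  by rewrite -sum_C1; exact/gmid/cardsC1_proper.
have := @sum_le_cosingletons alpha x 1 _ x1 C1.
have -> : \sum_q 1 * x q = \sum_q x q by apply: eq_bigr => q _; rewrite mul1r.
by nra.
Qed.

End Optimality.

End CoverLevel.
(** * Facets and the theorem *)

Lemma min_facilitiesP (R : realType) (b1 c : R) : 0 < b1 ->
  exists2 m : nat, min_facilities b1 c = m%:Z &
    forall k : nat, 0 <= b1 * k%:R + c <-> (m <= k)%N.
Proof.
move=> b0; have : 0 <= min_facilities b1 c by rewrite /min_facilities le_max lexx orbT.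
case E: (min_facilities b1 c) => [m|//] _; exists m => // k.
have : (min_facilities b1 c <= k%:Z) = (m <= k)%N by rewrite E lez_nat.
rewrite /min_facilities ge_max ceil_le_int andbT => <-.
by rewrite ler_pdivrMr // mulrC -lerBlDr sub0r.
Qed.

Section Facets.
Variables (R : realType) (Q T : finType) (t1 : T).
Variables (a : Q -> R) (b : T -> R) (c : R) (m : nat).
Hypothesis T1 : forall t : T, t = t1.
Hypothesis Q2 : (2 <= #|Q|)%N.
Hypothesis lvlP : forall (A : {set Q}) (k : nat),
  \sum_(q in A) a q <= b t1 * k%:R + c <-> (cover_lvl m A <= k)%N.

Let y1 (t : T) : R := (t == t1)%:R.
Let n : R := #|Q|%:R.

(** The tight points used are those of the empty set and of the sets
    [{d, i}], which are proper because [Q] has at least three elements. *)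
Lemma facet_single d : (3 <= #|Q|)%N ->
  defines_facet a b c (fun q => (q == d)%:R) y1 (- m%:R).
Proof.
move=> Q3.
have Amid i : (0 < #|[set d; i]%SET| < #|Q|)%N.
  by rewrite cards2 /=; apply: leq_trans Q3; case: (d != i).
apply: (defines_facet_lvl T1 lvlP (A0 := finset.set0)
          (A := fun i => [set d; i]%SET)).
- exact: valid_single.
- by rewrite big_set0 cover_lvl0 // subrr.
- move=> i; rewrite sum_indic cover_lvl_mid // !finset.inE eqxx /= -[m.+1%:R]natr1.
  by rewrite addrAC subrr add0r.
move=> k kA kl.
have kd i : i != d -> k i = 0.
  move=> id; rewrite -[RHS](kA i) (bigD1 i) //= !finset.inE eqxx orbT subr0.
  rewrite mulr1 big1 ?addr0 // => j ji.
  by rewrite !finset.inE (negPf id) eq_sym (negPf ji) subrr mulr0.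
move=> i; have [->|/kd//] := eqVneq i d.
rewrite -[RHS]kl (bigD1 d) //= big1 => [|j /kd->]; last by rewrite mul0r.
by rewrite cover_lvl_mid // cover_lvl0 // -[m.+1%:R]natr1 addrAC subrr add0r mulr1 addr0.
Qed.

Lemma facet_average : defines_facet a b c (fun=> 1 / (n - 1)) y1 (- m%:R).
Proof.
have n1 : n - 1 != 0 by rewrite subr_eq0 gt_eqF ?n_gt1.
apply: (defines_facet_lvl T1 lvlP (A0 := finset.set0)
          (A := fun i => [set~ i]%SET)).
- exact: valid_average.
- by rewrite big_set0 cover_lvl0 // subrr.
- move=> i; rewrite sum_C1 cover_lvlC1 // sumr_const -/n -[m.+1%:R]natr1.
  by rewrite -mulr_natl -/n; field.
move=> k kA kl i.
have {kl} k0 : \sum_i k i = 0.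
  rewrite -[RHS]kl; apply: eq_bigr => j _.
  by rewrite cover_lvlC1 // cover_lvl0 // -[m.+1%:R]natr1 addrAC subrr add0r mulr1.
have : 0 = \sum_j k j - k i.
  rewrite -[LHS](kA i) (bigD1 i) //= [in RHS](bigD1 i) //=.
  rewrite !finset.inE eqxx subrr mulr0 add0r addrAC subrr add0r.
  by apply: eq_bigr => j ji; rewrite !finset.inE eq_sym ji subr0 mulr1.
by rewrite k0 sub0r => /esym/eqP; rewrite oppr_eq0 => /eqP.
Qed.

Lemma facet_cover : defines_facet a b c (fun=> 1) y1 (- m%:R + n - 2).
Proof.
apply: (defines_facet_lvl T1 lvlP (A0 := finset.setT)
          (A := fun i => [set~ i]%SET)).
- exact: valid_cover.
- by rewrite sumr_const cardsT cover_lvlT // -[m.+2%:R]natr1 -[m.+1%:R]natr1 /n; ring.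
- by move=> i; rewrite sum_C1 cover_lvlC1 // sumr_const -/n -[m.+1%:R]natr1; ring.
move=> k kA _ i; apply/eqP; rewrite -oppr_eq0; apply/eqP.
rewrite -[RHS](kA i) (bigD1 i) //= !finset.inE eqxx sub0r mulrN1.
rewrite big1 ?addr0 // => j ji.
by rewrite !finset.inE eq_sym ji subrr mulr0.
Qed.

End Facets.

Theorem proposition6 (R : realType) (Q T : finType) (t1 : T)
    (a : Q -> R) (b : T -> R) (c : R) (r : R)
    (xbar : {ffun Q -> R^o}) (ybar : {ffun T -> R^o}) (d : Q)
    (hT : forall t : T, t = t1)
    (hQ : (0 < #|Q|)%N)
    (hb : 0 < b t1)
    (ha : forall q, 0 < a q)
    (hac : 0 < \sum_q a q - c)
    (hr : r = (min_facilities (b t1) c)%:~R)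
    (hd : forall q, xbar q <= xbar d)
    (hLP : flow_LP a b c (xbar, ybar))
    (hab : forall q, a q <= b t1)
    (hbr : forall q, b t1 * r + c < a q)
    (hcov : forall qbar : Q,
       \sum_q a q - a qbar <= b t1 * (r + 1) + c < \sum_q a q) :
  let y1 := fun t : T => (t == t1)%:R : R in
  let n := #|Q|%:R : R in
  let avg := (\sum_q xbar q) / (n - 1) in
  let solves := solves_separation a b c t1 (xbar, ybar) in
  let facet := defines_facet a b c in
  ((#|Q| <= 2)%N ->
     solves (fun=> 1) y1 (- r) /\ facet (fun=> 1) y1 (- r))
  /\
  ((3 <= #|Q|)%N ->
     [/\ avg <= xbar d -> solves (fun q => (q == d)%:R) y1 (- r),
         xbar d < avg <= 1 -> solves (fun=> 1 / (n - 1)) y1 (- r)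
       & 1 < avg -> solves (fun=> 1) y1 (- r + n - 2)]
     /\
     [/\ facet (fun q => (q == d)%:R) y1 (- r),
         facet (fun=> 1 / (n - 1)) y1 (- r)
       & facet (fun=> 1) y1 (- r + n - 2)]).
Proof.
move=> y1 n avg solves facet.
have [m mE mP] := min_facilitiesP c hb.
have {hr mE} rE : r = m%:R by rewrite hr mE.
rewrite {}rE in hbr hcov *.
have Q2 : (2 <= #|Q|)%N.
  (* A single commodity fits into [m + 1] facilities, as [a d <= b t1]; this
     contradicts the strict cover condition. *)
  have m0 := (mP m).2 (leqnn m).
  rewrite ltnNge; apply/negP => Q1.
  have sumE : \sum_q a q = a d.
    rewrite (bigD1 d) //= big1 ?addr0 // => q.
    by rewrite (fintype_le1P Q1 q d) eqxx.
  by have := hcov d; rewrite sumE => /andP[_]; have := hab d; lra.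
have lvlP := cover_lvlP Q2 hb ha mP hab hbr hcov.
have x01 q : 0 <= xbar q <= 1 by case: hLP.
have solve alpha gamma (valid : valid_ineq (cover_lvl m) alpha gamma) :=
  @solves_separation_lvl _ _ _ _ _ _ _ hT _ lvlP (xbar, ybar) _ _ valid.
have solve_average : (forall q, xbar q <= avg) -> avg <= 1 ->
    solves (fun=> 1 / (n - 1)) y1 (- m%:R).
  move=> xavg avg1; apply: solve; first exact: valid_average.
  by move=> alpha gamma; apply: optimal_average.
have solve_cover : 1 <= avg -> solves (fun=> 1) y1 (- m%:R + n - 2).
  move=> avg1; apply: solve; first exact: valid_cover.
  by move=> alpha gamma; apply: optimal_cover.
split=> [Qle2|Q3]; last first.
  split; split.
  - move=> avgd; apply: solve; first exact: valid_single.
    by move=> alpha gamma; apply: optimal_single.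
  - by case/andP=> davg; apply: solve_average => q; apply: le_trans (hd q) (ltW davg).
  - by move=> /ltW.
  - exact: facet_single.
  - exact: facet_average.
  - exact: facet_cover.
(* With two commodities [n - 1 = 1] and [n - 2 = 0]. *)
have nE : n = 2 by rewrite /n (_ : #|Q| = 2%N) //; apply/eqP; rewrite eqn_leq Qle2.
have coverE : - m%:R + n - 2 = - m%:R by rewrite nE addrK.
have nE1 : n - 1 = 1 by rewrite nE; ring.
have averageE : (fun=> 1 / (n - 1)) = (fun=> 1) :> (Q -> R).
  by apply/funext => q; rewrite nE1 divr1.
split; last by rewrite -coverE; apply: facet_cover.
have [avg1|/ltW avg1] := leP avg 1; last by rewrite -coverE; apply: solve_cover.
rewrite -averageE; apply: solve_average => // q.
rewrite /avg nE1 divr1 (bigD1 q) //= lerDl sumr_ge0 // => p _.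
by case/andP: (x01 p).
Qed.
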